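(* Let $k,n\ge1$, $0\le p\le1$, $\epsilon\ge0$, $\kappa\ge0$, let $\mathcal{D}_p(\rho)=(1-p)\rho+p\frac{I}{D}$ be the depolarizing channel on a $D$-dimensional Hilbert space $\mathcal{H}$, and declare two states on $\mathcal{H}^{\otimes k}$ neighbouring, $\rho\sim\sigma$, if $\frac12\|\rho-\sigma\|_1\le\kappa$. Then: (1) $\mathcal{D}_p^{\otimes k}$ is $(\epsilon,\delta)$-differentially private with $$\delta=\max\Big\{0,(1-e^\epsilon)\frac{p^k}{D^k}+(1-p^k)\kappa\Big\}.$$ (2) Let $\mathcal{A}=(\mathcal{D}_p^{\otimes k}\circ\mathcal{C}_n)\circ\cdots\circ(\mathcal{D}_p^{\otimes k}\circ\mathcal{C}_1)$ with $\mathcal{C}_1,\dots,\mathcal{C}_n$ quantum channels on $\mathcal{H}^{\otimes k}$. Then $\mathcal{A}$ is $(\epsilon,\delta)$-differentially private with $$\delta=\max\Big\{0,(1-e^\epsilon)\frac{p_\star}{D^k}+(1-p_\star)\kappa\Big\},\qquad p_\star=1-(1-p^k)^n.$$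
   Context: Hilbert spaces are finite-dimensional. A quantum channel is a completely positive trace-preserving map ($\mathcal{D}_p$ is extended linearly as $X\mapsto(1-p)X+p\operatorname{Tr}(X)I/D$). A channel $\mathcal{A}$ is $(\epsilon,\delta)$-differentially private if for all operators $0\le M\le I$ and all quantum states $\rho\sim\sigma$, $\operatorname{Tr}(M\mathcal{A}(\rho))\le e^\epsilon\operatorname{Tr}(M\mathcal{A}(\sigma))+\delta$. *)

(* Defs.v *)
From HB Require Import structures.
From mathcomp Require Import all_boot all_order all_algebra.
From mathcomp Require Import complex mxtens.
From mathcomp Require Import reals sequences.

Set Implicit Arguments.
Unset Strict Implicit.
Unset Printing Implicit Defensive.

Import Order.TTheory GRing.Theory Num.Theory.
Local Open Scope ring_scope.
Local Open Scope complex_scope.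
Local Open Scope sesquilinear_scope.

(* An n-dimensional Hilbert space is C^n with its standard inner product,
   operators on it are 'M[C]_n, and the tensor product of C^m and C^n is
   C^(m * n), via the Kronecker product [*t] of mxtens.
   The order of a numClosedFieldType is the partial one: [x <= y] means that
   y - x is a nonnegative real, so it forces x and y to have the same imaginary
   part. *)

Definition psdmx (C : numClosedFieldType) n (A : 'M[C]_n) : Prop :=
  forall v : 'cV[C]_n, 0 <= (v^t* *m A *m v) 0 0.

Definition loewner (C : numClosedFieldType) n (A B : 'M[C]_n) : Prop :=
  psdmx (B - A).

Definition density (C : numClosedFieldType) n (rho : 'M[C]_n) : Prop :=
  psdmx rho /\ \tr rho = 1.

(* The square root of a positive semidefinite matrix by spectral calculus:
   if A is normal then A = invmx U *m diag_mx d *m U with U = spectralmx A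
   unitary and d = spectral_diag A (orthomx_spectralP). *)
Definition sqrtmx (C : numClosedFieldType) n (A : 'M[C]_n) : 'M[C]_n :=
  invmx (spectralmx A) *m diag_mx (map_mx sqrtC (spectral_diag A))
    *m spectralmx A.

Definition trace_norm (C : numClosedFieldType) n (A : 'M[C]_n) : C :=
  \tr (sqrtmx (A^t* *m A)).

(* f (x) g, defined on the basis of matrix units E_ij (x) E_kl; meaningful for
   linear f and g (tens_map_tensmx). *)
Definition tens_map (C : numClosedFieldType) m m' n n'
    (f : 'M[C]_m -> 'M[C]_m') (g : 'M[C]_n -> 'M[C]_n')
    (X : 'M[C]_(m * n)) : 'M[C]_(m' * n') :=
  \sum_(i < m) \sum_(j < m) \sum_(k < n) \sum_(l < n)
     X (mxtens_index (i, k)) (mxtens_index (j, l)) *: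
       (f (delta_mx i j) *t g (delta_mx k l)).

Lemma tens_map_tensmx (C : numClosedFieldType) m m' n n'
    (f : {linear 'M[C]_m -> 'M[C]_m'})
    (g : {linear 'M[C]_n -> 'M[C]_n'}) (A : 'M_m) (B : 'M_n) :
  tens_map f g (A *t B) = f A *t g B.
Proof.
apply/matrixP=> s t.
case: (mxtens_indexP s) => a c; case: (mxtens_indexP t) => b d.
rewrite tensmxE [in RHS](matrix_sum_delta A) [in RHS](matrix_sum_delta B).
rewrite linear_sum /= !summxE mulr_suml; apply: eq_bigr => i _.
rewrite linear_sum /= !summxE mulr_suml; apply: eq_bigr => j _.
rewrite linear_sum /= !summxE mulr_sumr; apply: eq_bigr => k _.
rewrite linear_sum /= !summxE mulr_sumr; apply: eq_bigr => l _.
by rewrite !linearZ !mxE !mxtens_indexK /= mulrACA.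
Qed.

(* f^{(x) k} on C^(D ^ k).  The casts only identify D ^ k.+1 with D * D ^ k. *)
Fixpoint tens_pow (C : numClosedFieldType) D (f : 'M[C]_D -> 'M[C]_D) k :
    'M[C]_(D ^ k) -> 'M[C]_(D ^ k) :=
  match k with
  | 0 => id
  | k'.+1 => fun X =>
      let e := expnS D k' in
      castmx (esym e, esym e)
        (tens_map f (@tens_pow C D f k') (castmx (e, e) X))
  end.
Arguments tens_pow {C D} f k X.

Definition trace_preserving (C : numClosedFieldType) m n
    (f : 'M[C]_m -> 'M[C]_n) : Prop :=
  forall X, \tr (f X) = \tr X.

Definition completely_positive (C : numClosedFieldType) m n
    (f : 'M[C]_m -> 'M[C]_n) : Prop :=
  forall (r : nat) (X : 'M[C]_(r * m)),
    psdmx X -> psdmx (tens_map (@id 'M[C]_r) f X).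

Definition channel (C : numClosedFieldType) m n
    (f : 'M[C]_m -> 'M[C]_n) : Prop :=
  [/\ linear f, completely_positive f & trace_preserving f].

Definition depolarizing (R : realType) D (p : R) (X : 'M[R[i]]_D) :
    'M[R[i]]_D :=
  (1 - p%:C) *: X + (p%:C * \tr X / D%:R) *: 1%:M.
Arguments depolarizing {R} D p X.

Definition neighbours (R : realType) n (kappa : R) (rho sigma : 'M[R[i]]_n) :
    Prop :=
  1 / 2 * trace_norm (rho - sigma) <= kappa%:C.

Definition diff_private (R : realType) m n
    (nb : 'M[R[i]]_m -> 'M[R[i]]_m -> Prop) (eps delta : R)
    (A : 'M[R[i]]_m -> 'M[R[i]]_n) : Prop :=
  channel A /\
  forall (M : 'M[R[i]]_n) (rho sigma : 'M[R[i]]_m),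
    loewner 0 M -> loewner M 1%:M ->
    density rho -> density sigma -> nb rho sigma ->
    \tr (M *m A rho) <= (expR eps)%:C * \tr (M *m A sigma) + delta%:C.

(* (N o C_n) o ... o (N o C_1), where C_1 is C at the least index. *)
Definition noisy_circuit (T : Type) (N : T -> T) n (C : 'I_n -> T -> T) :
    T -> T :=
  foldl (fun A i => (N \o C i) \o A) id (enum 'I_n).

(* Main.v *)
From HB Require Import structures.
Require Import Defs.
From mathcomp Require Import all_boot all_order all_algebra.
From mathcomp Require Import complex mxtens ring.
From mathcomp Require Import reals sequences exp.
Import Order.TTheory GRing.Theory Num.Theory.
Local Open Scope ring_scope.

(** Write [q = p ^+ k] and [d = D ^ k]. The channel [N = D_p^(⊗k)] splits as
    [N X = F X + (q / d) (Tr X) I] with [F] completely positive. Track the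
    operator [X = A rho - e^eps A sigma], of trace [1 - e^eps <= 0], through the
    circuit: if [X <= P] with [P >= 0] and [Tr P <= delta], then
    [N (C X) <= F (C P) - a I] with [a = (e^eps - 1) q / d], and the positive
    part of the right-hand side has trace at most [max 0 ((1 - q) delta - a)].
    Starting from the positive part of [rho - sigma], of trace
    [1/2 ||rho - sigma||_1 <= kappa], the recursion for [delta] sums to the
    stated bound. *)

Set Implicit Arguments.
Unset Strict Implicit.
Unset Printing Implicit Defensive.
Local Open Scope sesquilinear_scope.

(** * Adjoints and their sesquilinear forms *)

Section Adjoint.
Variable C : numClosedFieldType.

Lemma adjmxM m n p (A : 'M[C]_(m, n)) (B : 'M[C]_(n, p)) :
  (A *m B)^t* = B^t* *m A^t*.
Proof. by rewrite trmx_mul map_mxM. Qed.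

Lemma adjmxD m n (A B : 'M[C]_(m, n)) : (A + B)^t* = A^t* + B^t*.
Proof. by rewrite linearD map_mxD. Qed.

Lemma adjmxB m n (A B : 'M[C]_(m, n)) : (A - B)^t* = A^t* - B^t*.
Proof. by rewrite linearB map_mxB. Qed.

Lemma adjmxZ m n a (A : 'M[C]_(m, n)) : (a *: A)^t* = a^* *: A^t*.
Proof. by rewrite linearZ map_mxZ. Qed.

Lemma adjmx_delta m n i j :
  (delta_mx i j : 'M[C]_(m, n))^t* = delta_mx j i.
Proof. by rewrite trmx_delta map_delta_mx. Qed.

Lemma adjmx_tens m n p q (A : 'M[C]_(m, n)) (B : 'M[C]_(p, q)) :
  (A *t B)^t* = A^t* *t B^t*.
Proof. by rewrite trmx_tens map_mxT. Qed.

Lemma adjmx_form n (A : 'M[C]_n) (v : 'cV[C]_n) :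
  (v^t* *m A^t* *m v) 0 0 = ((v^t* *m A *m v) 0 0)^*.
Proof.
transitivity (((v^t* *m A *m v)^t*) 0 0); last by rewrite !mxE.
by rewrite !adjmxM trmxCK mulmxA.
Qed.

Lemma delta_form n (A : 'M[C]_n) i j :
  ((delta_mx i 0 : 'cV[C]_n)^t* *m A *m (delta_mx j 0 : 'cV[C]_n)) 0 0 = A i j.
Proof. by rewrite adjmx_delta -rowE -colE !mxE. Qed.

End Adjoint.

(** * Positive semidefinite matrices, unitary diagonalization and the trace norm *)

Section Positive.
Variable C : numClosedFieldType.

Lemma psdmxD n (A B : 'M[C]_n) : psdmx A -> psdmx B -> psdmx (A + B).
Proof.
by move=> hA hB v; rewrite mulmxDr mulmxDl mxE addr_ge0 // (hA, hB).
Qed.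

Lemma psdmxZ n a (A : 'M[C]_n) : 0 <= a -> psdmx A -> psdmx (a *: A).
Proof.
by move=> ha hA v; rewrite -scalemxAr -scalemxAl mxE mulr_ge0.
Qed.

Lemma psdmx0 n : psdmx (0 : 'M[C]_n).
Proof. by move=> v; rewrite mulmx0 mul0mx mxE. Qed.

Lemma psdmx_sum n (I : Type) (r : seq I) (F : I -> 'M[C]_n) :
  (forall i, psdmx (F i)) -> psdmx (\sum_(i <- r) F i).
Proof.
by move=> hF; apply: big_rec => [|i A _ hA]; [exact: psdmx0|exact: psdmxD].
Qed.

Lemma psdmx_conj m n (K : 'M[C]_(m, n)) (A : 'M[C]_n) :
  psdmx A -> psdmx (K *m A *m K^t*).
Proof.
move=> hA v; have := hA (K^t* *m v).
by rewrite adjmxM trmxCK !mulmxA.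
Qed.

Lemma psdmx_diag n (d : 'rV[C]_n) :
  (forall i, 0 <= d 0 i) -> psdmx (diag_mx d).
Proof.
move=> hd v; rewrite mxE sumr_ge0 // => i _.
rewrite mul_mx_diag !mxE mulrAC mulr_ge0 //.
by rewrite mulrC -normCK exprn_ge0.
Qed.

Lemma mxform_eq0 n (B : 'M[C]_n) :
  (forall v : 'cV[C]_n, (v^t* *m B *m v) 0 0 = 0) -> B = 0.
Proof.
move=> hB.
(* Polarization with [e_i + c e_j] for [c = 1] and [c = 'i]. *)
have pol (i j : 'I_n) c : c * B i j + c^* * B j i = 0.
  have addE (X Y : 'M[C]_1) : (X + Y) 0 0 = X 0 0 + Y 0 0 by rewrite mxE.
  have scaleE a (X : 'M[C]_1) : (a *: X) 0 0 = a * X 0 0 by rewrite mxE.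
  have diag l : B l l = 0 by rewrite -delta_form hB.
  have := hB (delta_mx i 0 + c *: delta_mx j 0).
  rewrite adjmxD adjmxZ !mulmxDl !mulmxDr -!scalemxAl -!scalemxAr.
  by rewrite !(addE, scaleE) !delta_form !diag !mulr0 addr0 add0r.
apply/matrixP => i j; rewrite mxE.
have /eqP := pol i j 1; rewrite rmorph1 !mul1r addr_eq0 => /eqP hij.
have /eqP := pol i j 'i; rewrite conjCi mulNr subr_eq0 => /eqP.
move/(mulfI (neq0Ci _)) => h.
by move/eqP: hij; rewrite -h -addr_eq0 -mulr2n mulrn_eq0 /= => /eqP.
Qed.

(** The form of [A^t* - A] at [v] is the conjugate of a nonnegative, hence real, number minus that
    number. *)
Lemma psdmx_herm n (A : 'M[C]_n) : psdmx A -> A^t* = A.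
Proof.
move=> hA; apply/eqP; rewrite -subr_eq0; apply/eqP/mxform_eq0 => v.
rewrite mulmxBr mulmxBl mxE adjmx_form [X in _ + X]mxE.
by apply/eqP; rewrite subr_eq0 -CrealE ger0_real.
Qed.

Lemma hermmx_spectral n (A : 'M[C]_n) : A^t* = A ->
  exists (V : 'M[C]_n) (d : 'rV[C]_n),
    [/\ V *m V^t* = 1%:M, forall i, d 0 i \is Num.real
      & A = V^t* *m diag_mx d *m V].
Proof.
move=> hA; have hH : A \is hermsymmx.
  by apply/is_hermitianmxP; rewrite expr0 scale1r hA.
have U := spectral_unitarymx A.
exists (spectralmx A), (spectral_diag A); split.
- exact/unitarymxP.
- by move=> i; apply/mxOverP/hermitian_spectral_diag_real.
- by rewrite -invmx_unitary //; apply/orthomx_spectralP/hermitian_normalmx.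
Qed.

Lemma psdmx_spectral n (A : 'M[C]_n) : psdmx A ->
  exists (V : 'M[C]_n) (d : 'rV[C]_n),
    [/\ V *m V^t* = 1%:M, forall i, 0 <= d 0 i
      & A = V^t* *m diag_mx d *m V].
Proof.
move=> hA; have [V [d [hV hd eA]]] := hermmx_spectral (psdmx_herm hA).
exists V, d; split=> // i.
(* Here [V *m A *m V^t*] is [diag_mx d], and its form at the [i]-th basis vector is the eigenvalue
   [d 0 i]. *)
have /(_ (delta_mx i 0)) := psdmx_conj V hA.
rewrite delta_form eA !mulmxA hV mul1mx -mulmxA hV mulmx1.
by rewrite mxE eqxx mulr1n.
Qed.

Lemma mxtrace_unitary_diag n (V : 'M[C]_n) (d : 'rV[C]_n) :
  V *m V^t* = 1%:M -> \tr (V^t* *m diag_mx d *m V) = \sum_i d 0 i.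
Proof. by move=> hV; rewrite mxtrace_mulC mulmxA hV mul1mx mxtrace_diag. Qed.

Lemma psdmx_unitary_diag n (V : 'M[C]_n) (d : 'rV[C]_n) :
  (forall i, 0 <= d 0 i) -> psdmx (V^t* *m diag_mx d *m V).
Proof.
by move=> hd; have := psdmx_conj (V^t*) (psdmx_diag hd); rewrite trmxCK.
Qed.

(** Once [B] is diagonalized by [V], the trace is the sum of the eigenvalues of [B] weighted by the
    diagonal entries of [V *m A *m V^t*], all nonnegative. *)
Lemma psdmx_trM_ge0 n (A B : 'M[C]_n) :
  psdmx A -> psdmx B -> 0 <= \tr (A *m B).
Proof.
move=> hA /psdmx_spectral [V [d [hV hd ->]]].
rewrite !mulmxA mxtrace_mulC !mulmxA.
rewrite mul_mx_diag sumr_ge0 // => i _; rewrite mxE mulr_ge0 //.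
have /(_ (delta_mx i 0)) := psdmx_conj V hA.
by rewrite delta_form.
Qed.

(* The matrix [P] is the positive part of [Q - a]. If some eigenvalue of [Q]
   exceeds [a], subtracting [a] from that one alone already bounds [\tr P]. *)
Lemma psdmx_shift_pos n (Q : 'M[C]_n) (a b : C) :
  psdmx Q -> 0 <= a -> 0 <= b -> \tr Q - a <= b ->
  exists P, [/\ psdmx P, psdmx (P - (Q - a%:M)) & \tr P <= b].
Proof.
move=> /psdmx_spectral [V [d [hV hd ->]]] ha hb.
rewrite mxtrace_unitary_diag // => hQ.
have hV' : V^t* *m V = 1%:M by apply: mulmx1C.
(* The order on [C] is partial; comparing [a] with an eigenvalue rests on both being real. *)
have cmp i : a >=< d 0 i by apply: real_comparable; rewrite ger0_real.
pose e : 'rV[C]_n := \row_i if a <= d 0 i then d 0 i - a else 0.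
have e_ge0 i : 0 <= e 0 i.
  by rewrite mxE; case: ifP => // h; rewrite subr_ge0.
exists (V^t* *m diag_mx e *m V); split.
- exact: psdmx_unitary_diag.
- have -> : V^t* *m diag_mx e *m V - (V^t* *m diag_mx d *m V - a%:M)
     = V^t* *m diag_mx (e - d + const_mx a) *m V.
    have -> : diag_mx (e - d + const_mx a) = diag_mx e - diag_mx d + a%:M.
      by rewrite -diag_const_mx -linearB -linearD.
    rewrite mulmxDr mulmxBr mulmxDl mulmxBl.
    by rewrite mul_mx_scalar -scalemxAl hV' scalemx1 opprB addrA addrAC.
  apply: psdmx_unitary_diag => i; rewrite !mxE.
  case: ifP => h; first by rewrite addrAC addrNK subrr.
  by rewrite sub0r addrC subr_ge0; move: (cmp i); rewrite /Order.comparable h.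
- rewrite mxtrace_unitary_diag //.
  (* If no eigenvalue reaches [a], then [P] has trace 0 and [0 <= b] suffices. *)
  case: (pickP (fun i => a <= d 0 i)) => [j hj | h0]; last first.
    by rewrite big1 // => i _; rewrite mxE h0.
  apply: le_trans hQ; rewrite (bigD1 j) //= [X in _ <= X - _](bigD1 j) //=.
  rewrite mxE hj addrAC lerD2r lerD2l ler_sum // => i _; rewrite mxE.
  by case: ifP => // _; rewrite gerBl.
Qed.

(** Unique factorization of this polynomial shows that two unitary diagonalizations of one matrix
    have the same eigenvalues with multiplicity. *)
Lemma char_poly_unitary_diag n (V : 'M[C]_n) (d : 'rV[C]_n) :
  V *m V^t* = 1%:M ->
  char_poly (V^t* *m diag_mx d *m V) = \prod_(i < n) ('X - (d 0 i)%:P).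
Proof.
move=> hV; have hV' : V^t* *m V = 1%:M by apply: mulmx1C.
transitivity (char_poly (diag_mx d)).
  rewrite /char_poly.
  have -> : char_poly_mx (V^t* *m diag_mx d *m V) =
     map_mx polyC (V^t*) *m char_poly_mx (diag_mx d) *m map_mx polyC V.
    rewrite /char_poly_mx mulmxBr mulmxBl !map_mxM mul_mx_scalar -scalemxAl.
    by rewrite -(map_mxM _ (V^t*) V) hV' map_mx1 scalemx1.
  rewrite !det_mulmx mulrC mulrA -det_mulmx -map_mxM hV.
  by rewrite map_mx1 det1 mul1r.
rewrite char_poly_trig; last exact: diag_mx_is_trig.
by apply: eq_bigr => i _; rewrite mxE eqxx mulr1n.
Qed.

(** The trace norm is defined by a chosen diagonalization of [A^t* *m A], unrelated to [V]. Its
    eigenvalues are nevertheless the [d 0 i ^+ 2] up to order, with square roots the absolute values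
    of the [d 0 i]. *)
Lemma trace_norm_unitary_diag n (V : 'M[C]_n) (d : 'rV[C]_n) :
  V *m V^t* = 1%:M -> (forall i, d 0 i \is Num.real) ->
  trace_norm (V^t* *m diag_mx d *m V) = \sum_i `|d 0 i|.
Proof.
move=> hV hd; set A := V^t* *m diag_mx d *m V.
have hA : A^t* = A.
  rewrite /A !adjmxM trmxCK -mulmxA tr_diag_mx map_diag_mx.
  by congr (_ *m (diag_mx _ *m _)); apply/rowP => i; rewrite mxE; apply/CrealP.
have eA2 : A^t* *m A = V^t* *m diag_mx (\row_i (d 0 i ^+ 2)) *m V.
  rewrite hA /A !mulmxA -(mulmxA _ V (V^t*)) hV mulmx1.
  rewrite -(mulmxA _ (diag_mx d) (diag_mx d)).
  by rewrite mulmx_diag; do 3 congr (_ *m _); apply/rowP => i; rewrite !mxE.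
have hB : (A^t* *m A)^t* = A^t* *m A by rewrite adjmxM trmxCK.
have U := spectral_unitarymx (A^t* *m A).
rewrite /trace_norm /sqrtmx invmx_unitary //.
rewrite mxtrace_unitary_diag; last exact/unitarymxP.
have eB : A^t* *m A = (spectralmx (A^t* *m A))^t* *m
    diag_mx (spectral_diag (A^t* *m A)) *m spectralmx (A^t* *m A).
  rewrite -invmx_unitary //; apply/orthomx_spectralP/hermitian_normalmx.
  by apply/is_hermitianmxP; rewrite expr0 scale1r hB.
(* Both diagonalizations of [A^t* *m A] list the same eigenvalues. *)
have P : perm_eq [seq spectral_diag (A^t* *m A) 0 i | i <- index_enum 'I_n]
                 [seq d 0 i ^+ 2 | i <- index_enum 'I_n].
  apply: prod_XsubC_eq; rewrite !big_map /=.
  rewrite -(char_poly_unitary_diag (V := spectralmx (A^t* *m A))); last first.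
    exact/unitarymxP.
  rewrite -eB eA2 char_poly_unitary_diag //.
  by apply: eq_bigr => i _; rewrite mxE.
transitivity (\sum_(x <- [seq spectral_diag (A^t* *m A) 0 i
                          | i <- index_enum 'I_n]) sqrtC x).
  by rewrite big_map; apply: eq_bigr => i _; rewrite mxE.
rewrite (perm_big _ P) big_map; apply: eq_bigr => i _ /=.
by rewrite -real_normK // sqrCK.
Qed.

(* The matrix [P] is the positive part of [A]; as [\tr A = 0], it carries half
   of the trace norm. *)
Lemma trace_norm_pos_part n (A : 'M[C]_n) : A^t* = A -> \tr A = 0 ->
  exists P, [/\ psdmx P, psdmx (P - A) & \tr P = 1 / 2 * trace_norm A].
Proof.
move=> /hermmx_spectral [V [d [hV hd ->]]].
rewrite mxtrace_unitary_diag // trace_norm_unitary_diag // => h0.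
(* The entries [(|d| + d) / 2] are the positive parts of the eigenvalues; those of [P - A] are then
   [(|d| - d) / 2]. *)
exists (V^t* *m diag_mx (2^-1 *: (map_mx Num.norm d + d)) *m V).
have half i : 2^-1 * d 0 i + 2^-1 * d 0 i = d 0 i.
  by rewrite !(mulrC 2^-1) -splitr.
split.
- apply: psdmx_unitary_diag => i; rewrite !mxE mulr_ge0 ?invr_ge0 ?ler0n //.
  by rewrite -lerBlDr sub0r -normrN real_ler_norm // realN.
- rewrite -mulmxBl -mulmxBr -linearB /=; apply: psdmx_unitary_diag => i.
  rewrite !mxE mulrDr -[X in _ - X]half opprD addrA addrK -mulrBr.
  by rewrite mulr_ge0 ?invr_ge0 ?ler0n // subr_ge0 real_ler_norm.
- rewrite mxtrace_unitary_diag // div1r.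
  under eq_bigr do rewrite !mxE.
  by rewrite -mulr_sumr big_split /= h0 addr0.
Qed.

End Positive.

(** * Invariance under casts between equal dimensions *)

Section Cast.
Variables (C : numClosedFieldType) (m n : nat) (e : m = n).

Lemma psdmx_cast (A : 'M[C]_m) :
  psdmx (castmx (e, e) A) <-> psdmx A.
Proof. by case: n / e; rewrite castmx_id. Qed.

Lemma mxtrace_castmx (A : 'M[C]_m) :
  \tr (castmx (e, e) A) = \tr A.
Proof. by case: n / e; rewrite castmx_id. Qed.

Lemma castmxD (A B : 'M[C]_m) :
  castmx (e, e) (A + B) = castmx (e, e) A + castmx (e, e) B.
Proof. by case: n / e; rewrite !castmx_id. Qed.

Lemma castmx_scale1 (a : C) :
  castmx (e, e) (a *: 1%:M) = a *: 1%:M.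
Proof. by case: n / e; rewrite castmx_id. Qed.

End Cast.

(** * Tensor products of matrices and of maps *)

Section TensorMap.
Variable C : numClosedFieldType.

Lemma tensmxDl m n p q (A A' : 'M[C]_(m, n)) (B : 'M[C]_(p, q)) :
  (A + A') *t B = A *t B + A' *t B.
Proof. by apply/matrixP => i j; rewrite !mxE mulrDl. Qed.

Lemma tensmxDr m n p q (A : 'M[C]_(m, n)) (B B' : 'M[C]_(p, q)) :
  A *t (B + B') = A *t B + A *t B'.
Proof. by apply/matrixP => i j; rewrite !mxE mulrDr. Qed.

Lemma tensmx_suml m n p q I (r : seq I) (F : I -> 'M[C]_(m, n))
    (B : 'M[C]_(p, q)) :
  (\sum_(i <- r) F i) *t B = \sum_(i <- r) (F i *t B).
Proof.
exact: (big_morph (fun A => A *t B) (fun A A' => tensmxDl A A' B) (tens0mx B)).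
Qed.

Lemma tensmx_sumr m n p q I (r : seq I) (A : 'M[C]_(m, n))
    (F : I -> 'M[C]_(p, q)) :
  A *t (\sum_(i <- r) F i) = \sum_(i <- r) (A *t F i).
Proof. exact: (big_morph (tensmx A) (tensmxDr A) (tensmx0 A)). Qed.

Lemma mxtrace_tens m n (A : 'M[C]_m) (B : 'M[C]_n) :
  \tr (A *t B) = \tr A * \tr B.
Proof. by rewrite [RHS]mulr_sum; apply: eq_bigr => i _; rewrite mxE. Qed.

Lemma tensmx11 m n : (1%:M : 'M[C]_m) *t (1%:M : 'M[C]_n) = 1%:M.
Proof.
apply/matrixP => i j.
case: (mxtens_indexP i) => a b; case: (mxtens_indexP j) => c d.
rewrite tensmxE !mxE (can_eq (@mxtens_indexK m n)) xpair_eqE.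
by rewrite -natrM mulnb.
Qed.

Section Linear.
Variables (m m' n n' : nat).
Variables (f f' : 'M[C]_m -> 'M[C]_m') (g g' : 'M[C]_n -> 'M[C]_n').

(** Linearity in the argument holds for arbitrary [f] and [g], which are evaluated at matrix units
    only. *)
Lemma tens_map_is_linear : linear (tens_map f g).
Proof.
move=> a X Y; rewrite /tens_map scaler_sumr -big_split; apply: eq_bigr => i _.
rewrite scaler_sumr -big_split; apply: eq_bigr => j _.
rewrite scaler_sumr -big_split; apply: eq_bigr => k _.
rewrite scaler_sumr -big_split; apply: eq_bigr => l _ /=.
by rewrite !mxE scalerDl scalerA.
Qed.

HB.instance Definition _ := GRing.isLinear.Build C 'M[C]_(m * n)
  'M[C]_(m' * n') *:%R (tens_map f g) tens_map_is_linear.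

Lemma eq_tens_map : f =1 f' -> g =1 g' -> tens_map f g =1 tens_map f' g'.
Proof.
move=> ef eg X; rewrite /tens_map; apply: eq_bigr => i _; apply: eq_bigr => j _.
by apply: eq_bigr => k _; apply: eq_bigr => l _; rewrite ef eg.
Qed.

Lemma tens_mapDl X :
  tens_map (fun Y => f Y + f' Y) g X = tens_map f g X + tens_map f' g X.
Proof.
rewrite /tens_map -big_split; apply: eq_bigr => i _.
rewrite -big_split; apply: eq_bigr => j _.
rewrite -big_split; apply: eq_bigr => k _.
by rewrite -big_split; apply: eq_bigr => l _ /=; rewrite tensmxDl scalerDr.
Qed.

Lemma tens_mapDr X :
  tens_map f (fun Y => g Y + g' Y) X = tens_map f g X + tens_map f g' X.
Proof.
rewrite /tens_map -big_split; apply: eq_bigr => i _.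
rewrite -big_split; apply: eq_bigr => j _.
rewrite -big_split; apply: eq_bigr => k _.
by rewrite -big_split; apply: eq_bigr => l _ /=; rewrite tensmxDr scalerDr.
Qed.

End Linear.

(** Read from right to left, this expands [X] in tensor products of matrix units and so reduces
    linear identities to product matrices. *)
Lemma tens_map_id m n (X : 'M[C]_(m * n)) : tens_map id id X = X.
Proof.
rewrite /tens_map; apply/matrixP => s t.
case: (mxtens_indexP s) => a c; case: (mxtens_indexP t) => b d.
have sum1 (T : finType) (x : T) (F : T -> C) :
    (forall y, y != x -> F y = 0) -> \sum_y F y = F x.
  by move=> h; rewrite (bigD1 x) //= big1 ?addr0.
rewrite summxE (sum1 _ a) => [|i /negPf hi]; last first.
  rewrite summxE big1 // => j _; rewrite summxE big1 // => k _.
  rewrite summxE big1 // => l _; rewrite mxE tensmxE !mxE.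
  by rewrite [a == i]eq_sym hi mul0r mulr0.
rewrite summxE (sum1 _ b) => [|j /negPf hj]; last first.
  rewrite summxE big1 // => k _; rewrite summxE big1 // => l _.
  by rewrite mxE tensmxE !mxE [b == j]eq_sym hj andbF mul0r mulr0.
rewrite summxE (sum1 _ c) => [|k /negPf hk]; last first.
  rewrite summxE big1 // => l _.
  by rewrite mxE tensmxE !mxE [c == k]eq_sym hk !mulr0.
rewrite summxE (sum1 _ d) => [|l /negPf hl]; last first.
  by rewrite mxE tensmxE !mxE [d == l]eq_sym hl andbF !mulr0.
by rewrite mxE tensmxE !mxE !eqxx !mulr1.
Qed.

(** The inner map yields a combination of products [f E_ij *t g E_kl], on which the outer linear
    maps act factor by factor. *)
Lemma tens_map_comp m m' m'' n n' n''
    (f : 'M[C]_m -> 'M[C]_m') (g : 'M[C]_n -> 'M[C]_n')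
    (f' : 'M[C]_m' -> 'M[C]_m'') (g' : 'M[C]_n' -> 'M[C]_n'') X :
  linear f' -> linear g' ->
  tens_map (f' \o f) (g' \o g) X = tens_map f' g' (tens_map f g X).
Proof.
move=> lf lg.
pose F : {linear _ -> _} := HB.pack f' (GRing.isLinear.Build _ _ _ _ f' lf).
pose G : {linear _ -> _} := HB.pack g' (GRing.isLinear.Build _ _ _ _ g' lg).
rewrite [tens_map f g X]/tens_map [LHS]/tens_map.
rewrite linear_sum; apply: eq_bigr => i _.
rewrite linear_sum; apply: eq_bigr => j _.
rewrite linear_sum; apply: eq_bigr => k _.
rewrite linear_sum; apply: eq_bigr => l _.
by rewrite linearZ /=; congr (_ *: _); rewrite (tens_map_tensmx F G).
Qed.

Lemma tens_map_tr m m' n n' (f : 'M[C]_m -> 'M[C]_m')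
    (g : 'M[C]_n -> 'M[C]_n') :
  trace_preserving f -> trace_preserving g -> trace_preserving (tens_map f g).
Proof.
move=> hf hg X; rewrite -[in RHS](tens_map_id X) /tens_map.
rewrite !linear_sum; apply: eq_bigr => i _.
rewrite !linear_sum; apply: eq_bigr => j _.
rewrite !linear_sum; apply: eq_bigr => k _.
rewrite !linear_sum; apply: eq_bigr => l _.
by rewrite !linearZ /= !mxtrace_tens hf hg.
Qed.

(** Weights of fully depolarizing maps multiply under tensor products; this is the source of the
    factor [p ^+ k]. *)
Lemma tens_map_trace m m' n n' (f : 'M[C]_m -> 'M[C]_m')
    (g : 'M[C]_n -> 'M[C]_n') (a b : C) X :
  (forall A, f A = (a * \tr A) *: 1%:M) ->
  (forall B, g B = (b * \tr B) *: 1%:M) ->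
  tens_map f g X = (a * b * \tr X) *: 1%:M.
Proof.
move=> hf hg; rewrite -[in RHS](tens_map_id X) /tens_map.
rewrite linear_sum mulr_sumr scaler_suml; apply: eq_bigr => i _.
rewrite linear_sum mulr_sumr scaler_suml; apply: eq_bigr => j _.
rewrite linear_sum mulr_sumr scaler_suml; apply: eq_bigr => k _.
rewrite linear_sum mulr_sumr scaler_suml; apply: eq_bigr => l _.
rewrite linearZ /= mxtrace_tens hf hg -tensmx11.
by apply/matrixP => u v; rewrite !mxE; ring.
Qed.

End TensorMap.

(** * Maps in operator-sum form and their complete positivity *)

Section Kraus.
Variable C : numClosedFieldType.

Definition kraus_sum m n (s : seq 'M[C]_(n, m)) (X : 'M[C]_m) : 'M[C]_n :=
  \sum_(K <- s) K *m X *m K^t*.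

(** Complete positivity is established through this form, which visibly preserves positivity and is
    stable under sums, nonnegative multiples and tensor products. *)
Definition kraus m n (f : 'M[C]_m -> 'M[C]_n) :=
  exists s, f =1 kraus_sum s.

Lemma kraus_sum_is_linear m n (s : seq 'M[C]_(n, m)) : linear (kraus_sum s).
Proof.
move=> a X Y; rewrite /kraus_sum scaler_sumr -big_split; apply: eq_bigr => K _.
by rewrite /= mulmxDr mulmxDl -scalemxAr -scalemxAl.
Qed.

HB.instance Definition _ m n (s : seq 'M[C]_(n, m)) :=
  GRing.isLinear.Build C 'M[C]_m 'M[C]_n *:%R (kraus_sum s)
    (kraus_sum_is_linear s).

Lemma kraus_linear m n (f : 'M[C]_m -> 'M[C]_n) : kraus f -> linear f.
Proof. by case=> s hs a X Y; rewrite !hs linearP. Qed.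

Lemma kraus_psdmx m n (f : 'M[C]_m -> 'M[C]_n) X :
  kraus f -> psdmx X -> psdmx (f X).
Proof. by case=> s -> hX; apply: psdmx_sum => K; apply: psdmx_conj. Qed.

Lemma eq_kraus m n (f g : 'M[C]_m -> 'M[C]_n) : f =1 g -> kraus f -> kraus g.
Proof. by move=> fg [s hs]; exists s => X; rewrite -fg. Qed.

Lemma kraus_id n : kraus (@id 'M[C]_n).
Proof.
exists [:: 1%:M] => X.
by rewrite /kraus_sum big_seq1 trmx1 map_mx1 mul1mx mulmx1.
Qed.

Lemma krausD m n (f g : 'M[C]_m -> 'M[C]_n) :
  kraus f -> kraus g -> kraus (fun X => f X + g X).
Proof.
by move=> [s hs] [t ht]; exists (s ++ t) => X; rewrite hs ht /kraus_sum big_cat.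
Qed.

Lemma krausZ m n a (f : 'M[C]_m -> 'M[C]_n) :
  0 <= a -> kraus f -> kraus (fun X => a *: f X).
Proof.
move=> ha [s hs]; exists [seq sqrtC a *: K | K <- s] => X.
rewrite hs /kraus_sum big_map scaler_sumr; apply: eq_bigr => K _.
rewrite adjmxZ -!scalemxAl -scalemxAr scalerA.
by rewrite (CrealP _) ?ger0_real ?sqrtC_ge0 // -expr2 sqrtCK.
Qed.

(** For [c = 1] the Kraus operators are all matrix units, as the sum of [E_ij X E_ji] over [i] and
    [j] is [\tr X] times the identity. *)
Lemma kraus_trace m n c : 0 <= c ->
  kraus (fun X : 'M[C]_m => (c * \tr X) *: (1%:M : 'M[C]_n)).
Proof.
move=> hc.
suff : kraus (fun X : 'M[C]_m => c *: (\tr X *: (1%:M : 'M[C]_n))).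
  by apply: eq_kraus => X; rewrite scalerA.
apply: krausZ => //.
exists [seq delta_mx i j | i <- index_enum 'I_n, j <- index_enum 'I_m] => X.
rewrite /kraus_sum big_allpairs_dep.
have -> : (1%:M : 'M[C]_n) = \sum_i delta_mx i i.
  rewrite [LHS]matrix_sum_delta; apply: eq_bigr => i _.
  rewrite (bigD1 i) //= big1 ?addr0 ?mxE ?eqxx ?scale1r // => j /negPf hj.
  by rewrite mxE eq_sym hj scale0r.
rewrite scaler_sumr; apply: eq_bigr => i _; rewrite scaler_suml.
apply: eq_bigr => j _; rewrite adjmx_delta.
(* Factoring [E_ij] as a column times a row isolates a [1 x 1] block, the scalar [X j j]. *)
have -> : delta_mx i j *m X *m delta_mx j i = delta_mx i (0 : 'I_1)
    *m (delta_mx (0 : 'I_1) j *m X *m delta_mx j (0 : 'I_1)) *m delta_mx 0 i.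
  by rewrite !mulmxA mul_delta_mx -!mulmxA mul_delta_mx.
rewrite -rowE -colE [col _ _]mx11_scalar mul_mx_scalar -scalemxAl.
by rewrite mul_delta_mx !mxE.
Qed.

Lemma kraus_sum_tens m m' n n' (s : seq 'M[C]_(m', m)) (t : seq 'M[C]_(n', n))
    A B :
  kraus_sum s A *t kraus_sum t B
  = kraus_sum [seq K *t L | K <- s, L <- t] (A *t B).
Proof.
rewrite /kraus_sum big_allpairs_dep tensmx_suml; apply: eq_bigr => K _.
rewrite tensmx_sumr; apply: eq_bigr => L _.
by rewrite adjmx_tens !tensmx_mul.
Qed.

(** The products [K *t L] serve as Kraus operators; by linearity it is enough to check this on
    tensor products of matrix units. *)
Lemma kraus_tens m m' n n' (f : 'M[C]_m -> 'M[C]_m') (g : 'M[C]_n -> 'M[C]_n') :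
  kraus f -> kraus g -> kraus (tens_map f g).
Proof.
move=> [s hs] [t ht]; exists [seq K *t L | K <- s, L <- t] => X.
rewrite -[in RHS](tens_map_id X) /tens_map.
rewrite linear_sum; apply: eq_bigr => i _.
rewrite linear_sum; apply: eq_bigr => j _.
rewrite linear_sum; apply: eq_bigr => k _.
rewrite linear_sum; apply: eq_bigr => l _.
by rewrite linearZ /= -kraus_sum_tens hs ht.
Qed.

Lemma kraus_cast m n (e : m = n) (f : 'M[C]_n -> 'M[C]_n) :
  kraus f ->
  kraus (fun X => castmx (esym e, esym e) (f (castmx (e, e) X))).
Proof.
case: n / e f => f; apply: eq_kraus => X.
by rewrite !castmx_id.
Qed.

Lemma kraus_completely_positive m n (f : 'M[C]_m -> 'M[C]_n) :
  kraus f -> completely_positive f.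
Proof.
move=> hf r X; apply: kraus_psdmx; exact: kraus_tens (@kraus_id r) hf.
Qed.

End Kraus.

(** * Positivity and composition of channels *)

Section Channel.
Variable C : numClosedFieldType.

(* Complete positivity with a one-dimensional ancilla. *)
Lemma channel_psdmx m n (f : 'M[C]_m -> 'M[C]_n) X :
  channel f -> psdmx X -> psdmx (f X).
Proof.
move=> [lf cp _] hX.
pose F : {linear _ -> _} := HB.pack f (GRing.isLinear.Build _ _ _ _ f lf).
have := cp 1%N (1 *t X).
rewrite -[f]/(F : _ -> _) (tens_map_tensmx idfun F) !tens_scalar1mx.
by rewrite !psdmx_cast; exact.
Qed.

Lemma channel_comp m n p (f : 'M[C]_n -> 'M[C]_p) (g : 'M[C]_m -> 'M[C]_n) :
  channel f -> channel g -> channel (f \o g).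
Proof.
move=> [lf cf tf] [lg cg tg]; split.
- by move=> a X Y /=; rewrite lg lf.
- move=> r X hX; have lid : linear (@id 'M[C]_r) by [].
  have -> : tens_map id (f \o g) X = tens_map id f (tens_map id g X).
    exact: (tens_map_comp id g X lid lf).
  exact/cf/cg.
- by move=> X /=; rewrite tf tg.
Qed.

Lemma channel_id n : channel (@id 'M[C]_n).
Proof. by split=> // r X; rewrite tens_map_id. Qed.

Lemma noisy_foldl_channel n (N : 'M[C]_n -> 'M[C]_n) (I : Type)
    (G : I -> 'M[C]_n -> 'M[C]_n) (s : seq I) :
  channel N -> (forall i, channel (G i)) ->
  channel (foldl (fun A i => (N \o G i) \o A) id s).
Proof.
(* Induction runs from the end of the list, whose last element is the outermost layer. *)
move=> hN hG; elim/last_ind: s => [|s i IH] /=; first exact: channel_id.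
by rewrite foldl_rcons; apply: channel_comp => //; apply: channel_comp.
Qed.

End Channel.

(** * Depolarizing noise and the propagation of the privacy bound *)

Section Depolarizing.
Variable R : realType.
Local Open Scope complex_scope.
Local Notation C := R[i].

Lemma depolarizing_tr D p : (1 <= D)%N ->
  trace_preserving (@depolarizing R D p).
Proof.
move=> hD X; rewrite /depolarizing linearD !linearZ /= mxtrace1.
rewrite divfK ?pnatr_eq0 -?lt0n //.
by rewrite mulrBl mul1r subrK.
Qed.

(* Splitting off from the tensor power its fully depolarizing part, of weight
   [p ^+ k], leaves a completely positive remainder. *)
Lemma tens_pow_depolarizing_split D k (p : R) : (1 <= D)%N -> 0 <= p <= 1 ->
  exists2 F : 'M[C]_(D ^ k) -> 'M[C]_(D ^ k), kraus F &
    forall X, tens_pow (depolarizing D p) k X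
              = F X + ((p ^+ k / D%:R ^+ k)%:C * \tr X) *: 1%:M.
Proof.
move=> hD /andP[p0 p1].
elim: k => [|k [F kF hF]].
  (* In dimension [D ^ 0 = 1] the identity is already fully depolarizing, with weight 1. *)
  exists (fun X => 0); first by exists [::] => X; rewrite /kraus_sum big_nil.
  move=> X; rewrite add0r /= !expr0 divr1 mul1r scalemx1.
  by rewrite trace_mx11 -mx11_scalar.
pose c : C := p%:C / D%:R.
pose q : C := (p ^+ k / D%:R ^+ k)%:C.
have c0 : 0 <= c by rewrite divr_ge0 ?ler0n // lecR.
have q0 : 0 <= q by rewrite lecR divr_ge0 ?exprn_ge0 ?ler0n.
have p0' : 0 <= 1 - p%:C by rewrite subr_ge0 lecR.
pose N := tens_pow (depolarizing D p) k.
have kN : kraus N.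
  apply: eq_kraus (krausD kF (kraus_trace _ _ q0)) => X.
  by rewrite /N hF.
(* Of the products obtained by splitting both factors, [G] gathers all but the fully depolarizing
   part of each; that last one has coefficient [c * q]. *)
pose G X := tens_map (fun Y => (1 - p%:C) *: Y) N X
   + tens_map (fun Y : 'M[C]_D => (c * \tr Y) *: 1%:M) F X.
exists (fun X => let e := expnS D k in
         castmx (esym e, esym e) (G (castmx (e, e) X))).
  apply: kraus_cast; apply: krausD; apply: kraus_tens => //.
    by apply: krausZ => //; exact: kraus_id.
  exact: kraus_trace.
move=> X /=; set e := expnS D k; set Y := castmx _ X.
have -> : \tr X = \tr Y by rewrite /Y mxtrace_castmx.
have eT : tens_map (depolarizing D p) N Y =
    G Y + ((p ^+ k.+1 / D%:R ^+ k.+1)%:C * \tr Y) *: 1%:M.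
  rewrite (eq_tens_map (f' := fun Z => (1 - p%:C) *: Z + (c * \tr Z) *: 1%:M)
    (g' := N)) //; last first.
    by move=> Z; rewrite /depolarizing /c mulrAC.
  rewrite tens_mapDl /G -addrA; congr (_ + _).
  rewrite (eq_tens_map (f' := fun Z => (c * \tr Z) *: 1%:M) (g' := fun Z =>
     F Z + (q * \tr Z) *: 1%:M)) // tens_mapDr; congr (_ + _).
  rewrite (tens_map_trace (a := c) (b := q)) //; congr (_ * _ *: _).
  rewrite /c /q !exprS invfM !rmorphM /= !fmorphV !rmorph_nat.
  ring.
by rewrite -/N eT castmxD castmx_scale1.
Qed.

Lemma tens_pow_tr D (f : 'M[C]_D -> 'M[C]_D) k :
  trace_preserving f -> trace_preserving (tens_pow f k).
Proof.
move=> hf; elim: k => // k IH X /=.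
by rewrite mxtrace_castmx (tens_map_tr hf IH) mxtrace_castmx.
Qed.

Lemma tens_pow_depolarizing_channel D k (p : R) : (1 <= D)%N -> 0 <= p <= 1 ->
  channel (tens_pow (depolarizing D p) k).
Proof.
move=> hD hp; have [F kF hF] := tens_pow_depolarizing_split k hD hp.
have /andP[p0 _] := hp.
have kN : kraus (tens_pow (depolarizing D p) k).
  have q0 : 0 <= (p ^+ k / D%:R ^+ k)%:C :> C.
    by rewrite lecR divr_ge0 ?exprn_ge0 ?ler0n.
  apply: eq_kraus (krausD kF (kraus_trace _ _ q0)) => X.
  by rewrite hF.
split; first exact: kraus_linear.
  exact: kraus_completely_positive.
exact/tens_pow_tr/depolarizing_tr.
Qed.

(* With [X = A rho - e^eps A sigma], this is the operator form of the bound
   [\tr (M X) <= delta] for all [0 <= M <= 1]. *)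
Definition pos_part_le n (X : 'M[C]_n) (delta : R) : Prop :=
  exists P, [/\ psdmx P, psdmx (P - X) & \tr P <= delta%:C].

(** With [P] the witness, [\tr (M X) <= \tr (M P) <= \tr P], each gap being the trace of a product
    of two positive matrices. *)
Lemma pos_part_le_test n (X M : 'M[C]_n) delta :
  pos_part_le X delta -> psdmx M -> psdmx (1%:M - M) ->
  \tr (M *m X) <= delta%:C.
Proof.
move=> [P [hP hX hd]] hM hM1; apply: le_trans hd.
apply: (@le_trans _ _ (\tr (M *m P))).
  by rewrite -subr_ge0 -linearB -mulmxBr; apply: psdmx_trM_ge0.
by rewrite -subr_ge0 -linearB -{1}(mul1mx P) -mulmxBl; apply: psdmx_trM_ge0.
Qed.

(** The positive part of [rho - sigma] is a witness: replacing [sigma] by [gamma] times [sigma] only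
    lowers the operator, and its trace is half the trace norm. *)
Lemma pos_part_le_neighbours n (rho sigma : 'M[C]_n) (kappa gamma : R) :
  density rho -> density sigma -> neighbours kappa rho sigma -> 1 <= gamma ->
  pos_part_le (rho - gamma%:C *: sigma) kappa.
Proof.
move=> [hr tr] [hs ts] hn hg.
have [|| P [hP hPX hPt]] := @trace_norm_pos_part _ _ (rho - sigma).
- by rewrite adjmxB !psdmx_herm.
- by rewrite linearB /= tr ts subrr.
exists P; split=> //; last by rewrite hPt.
have -> : P - (rho - gamma%:C *: sigma)
    = P - (rho - sigma) + (gamma%:C - 1) *: sigma.
  by apply/matrixP => u v; rewrite !mxE; ring.
by apply: psdmxD => //; apply: psdmxZ => //; rewrite subr_ge0 lecR.
Qed.

(** This is one layer of the circuit. Since [N] preserves the trace, [F] scales it by [1 - c * n],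
    so [F (G P)] has trace at most [(1 - c * n) * delta]. The scalar term of [N (G X)] is [- a]
    because [\tr X = 1 - gamma]. The new witness comes from the positive part of [F (G P) - a]. *)
Lemma pos_part_le_mix n (N G : 'M[C]_n -> 'M[C]_n) (F : 'M[C]_n -> 'M[C]_n)
    (X : 'M[C]_n) (c delta delta' gamma : R) :
  channel N -> channel G -> kraus F ->
  (forall Y, N Y = F Y + (c%:C * \tr Y) *: 1%:M) ->
  0 <= c -> 1 <= gamma -> \tr X = (1 - gamma)%:C -> c * n%:R <= 1 ->
  0 <= delta' -> (1 - gamma) * c + (1 - c * n%:R) * delta <= delta' ->
  pos_part_le X delta -> pos_part_le (N (G X)) delta'.
Proof.
move=> [_ _ tN] hG kF hN c0 hg hX hcn hd' hle [P [hP hPX hPt]].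
have [lG _ tG] := hG.
have trF Y : \tr (F Y) = (1 - c%:C * n%:R) * \tr Y.
  have := tN Y; rewrite hN linearD linearZ /= mxtrace1 => /eqP.
  rewrite -[_ == _]subr_eq0 => /eqP h.
  by apply/eqP; rewrite -subr_eq0 -h; apply/eqP; ring.
pose a := (gamma - 1) * c.
have [|||| P' [hP' hPX' hPt']] :=
    @psdmx_shift_pos _ n (F (G P)) a%:C delta'%:C.
- exact/kraus_psdmx/channel_psdmx.
- by rewrite lecR mulr_ge0 // subr_ge0.
- by rewrite lecR.
- rewrite trF tG lerBlDr.
  apply: le_trans (_ : ((1 - c * n%:R) * delta)%:C <= _).
    have -> : c%:C * n%:R = (c * n%:R)%:C :> C by rewrite rmorphM /= rmorph_nat.
    have -> : 1 - (c * n%:R)%:C = (1 - c * n%:R)%:C :> C.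
      by rewrite rmorphB rmorph1.
    by rewrite rmorphM; apply: ler_wpM2l => //; rewrite lecR subr_ge0.
  rewrite -rmorphD lecR /a -lerBlDr; apply: le_trans hle.
  by rewrite le_eqVlt; apply/predU1l; ring.
exists P'; split=> //.
have lF := kraus_linear kF.
(* The second summand is the image of the positive matrix [P - X] under the positive map
   [F \o G]. *)
have -> : P' - N (G X) = P' - (F (G P) - a%:C%:M) + F (G (P - X)).
  have -> : P - X = (-1) *: X + P by rewrite scaleN1r addrC.
  rewrite lG lF hN tG hX.
  have -> : c%:C * (1 - gamma)%:C = - a%:C.
    by rewrite -rmorphM -rmorphN /= /a; congr _%:C; ring.
  by apply/matrixP => u v; rewrite !mxE; ring.
apply: psdmxD => //; exact/kraus_psdmx/channel_psdmx.
Qed.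

(** A list of arbitrary index type covers both claims and allows induction on the number of
    layers. *)
Lemma noisy_foldl_private D k (p eps kappa : R) (I : Type)
    (G : I -> 'M[C]_(D ^ k) -> 'M[C]_(D ^ k)) (s : seq I) :
  (1 <= D)%N -> 0 <= p <= 1 -> 0 <= eps -> 0 <= kappa ->
  (forall i, channel (G i)) ->
  let pstar := 1 - (1 - p ^+ k) ^+ size s in
  diff_private (neighbours kappa) eps
    (Num.max 0 ((1 - expR eps) * (pstar / D%:R ^+ k) + (1 - pstar) * kappa))
    (foldl (fun A i => (tens_pow (depolarizing D p) k \o G i) \o A) id s).
Proof.
move=> hD hp heps hkappa hG /=.
set N := tens_pow _ _.
have cN : channel N by exact: tens_pow_depolarizing_channel.
set gamma := expR eps.
have hg : 1 <= gamma by rewrite -[1]expR0 ler_expR.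
have [F kF hF] := tens_pow_depolarizing_split k hD hp.
have /andP[p0 p1] := hp.
have q0 : 0 <= p ^+ k by exact: exprn_ge0.
have q1 : p ^+ k <= 1 by exact: exprn_ile1.
have d0 : 0 < D%:R ^+ k :> R by rewrite exprn_gt0 // ltr0n.
split=> [|M rho sigma]; first exact: noisy_foldl_channel.
rewrite /loewner subr0 => hM0 hM1 hr hs hn.
have [lA _ _] := noisy_foldl_channel s cN hG.
(* By linearity, privacy is a bound on the test values of the image of [rho - gamma%:C *: sigma]. *)
suff h : pos_part_le (foldl (fun A i => (N \o G i) \o A) id s
      (rho - gamma%:C *: sigma))
    (Num.max 0 ((1 - gamma) * ((1 - (1 - p ^+ k) ^+ size s) / D%:R ^+ k)
      + (1 - (1 - (1 - p ^+ k) ^+ size s)) * kappa)).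
  have := pos_part_le_test h hM0 hM1.
  have -> : rho - gamma%:C *: sigma = (- gamma%:C) *: sigma + rho.
    by rewrite scaleNr addrC.
  rewrite lA scaleNr mulmxDr mulmxN -scalemxAr linearD linearN linearZ /=.
  by rewrite addrC lerBlDl.
have hX : \tr (rho - gamma%:C *: sigma) = (1 - gamma)%:C.
  case: hr hs => _ tr [_ ts].
  by rewrite linearB linearZ /= tr ts mulr1 rmorphB rmorph1.
elim/last_ind: s {lA} => [|s i IH] /=.
  (* With no layer [pstar] is 0, and the bound is [kappa]. *)
  rewrite expr0 subrr mul0r mulr0 add0r subr0 mul1r max_r //.
  exact: pos_part_le_neighbours.
rewrite foldl_rcons size_rcons /=.
have [_ _ tA] := noisy_foldl_channel s cN hG.
have eq : p ^+ k / D%:R ^+ k * (D ^ k)%:R = p ^+ k.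
  by rewrite natrX divfK // gt_eqF.
apply: (pos_part_le_mix cN (hG i) kF hF _ hg _ _ _ _ IH).
- by rewrite divr_ge0 // ltW.
- by rewrite tA.
- by rewrite eq.
- by rewrite le_max lexx.
rewrite eq; set w := (1 - p ^+ k) ^+ size s.
have w1 : w <= 1 by rewrite exprn_ile1 ?subr_ge0 // gerBl.
(* The factor [1 - p ^+ k] enters the maximum. Its zero branch leaves a nonpositive term; in the
   other, with [q = p ^+ k], the recursion closes by [q + (1 - q) * (1 - w) = 1 - w * (1 - q)]. *)
rewrite maxr_pMr ?subr_ge0 // mulr0.
rewrite addr_maxr addr0 ge_max !le_max; apply/andP; split.
  by apply/orP; left; rewrite mulr_le0_ge0 ?subr_le0 // divr_ge0 // ltW.
apply/orP; right; rewrite exprSr -/w le_eqVlt; apply/predU1l.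
by field; rewrite gt_eqF.
Qed.

End Depolarizing.

Theorem mainTheorem7 (R : realType) (D k n : nat) (p eps kappa : R)
    (hD : (1 <= D)%N) (hk : (1 <= k)%N) (hn : (1 <= n)%N)
    (hp : 0 <= p <= 1) (heps : 0 <= eps) (hkappa : 0 <= kappa) :
  diff_private (neighbours kappa) eps
    (Num.max 0 ((1 - expR eps) * (p ^+ k / D%:R ^+ k) + (1 - p ^+ k) * kappa))
    (tens_pow (depolarizing D p) k)
  /\
  (forall C : 'I_n -> 'M[R[i]]_(D ^ k) -> 'M[R[i]]_(D ^ k),
     (forall i, channel (C i)) ->
     let pstar := 1 - (1 - p ^+ k) ^+ n in
     diff_private (neighbours kappa) eps
       (Num.max 0 ((1 - expR eps) * (pstar / D%:R ^+ k) + (1 - pstar) * kappa))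
       (noisy_circuit (tens_pow (depolarizing D p) k) C)).
Proof.
split=> [|C hC pstar].
  (* The first claim is a single layer with the identity channel, where [pstar] reduces to
     [p ^+ k]. *)
  have := @noisy_foldl_private R D k p eps kappa unit (fun=> id) [:: tt]
    hD hp heps hkappa (fun=> channel_id _ _).
  by rewrite /= expr1 subKr.
have := noisy_foldl_private (enum 'I_n) hD hp heps hkappa hC.
by rewrite size_enum_ord.
Qed.
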